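(* Let $\Omega\subseteq\mathbb{R}^n$ be open. For $i=1,\dots,n$ we have $\mathrm{D}_i(\mathcal{M}^{\mathrm{c}}(\Omega))\subseteq\mathcal{M}^{\mathrm{c}}(\Omega)$ and $\mathrm{D}_i(\mathcal{N}^{\mathrm{c}}(\Omega))\subseteq\mathcal{N}^{\mathrm{c}}(\Omega)$.
   Context: Notation: $\mathbb{R}^+=[0,\infty)$. $K\Subset L$ means that $K$ is compact and contained in the interior of $L$. $\mathcal{U}_x(\Omega)$ is the set of open neighborhoods of $x$ in $\Omega$; $\mathcal{D}(\mathbb{R}^n)$ is the space of (complex-valued) test functions. $U(\Omega)=\{(\varphi,x)\in\mathcal{D}(\mathbb{R}^n)\times\Omega : x+\operatorname{supp}\varphi\subseteq\Omega\}$. $\mathcal{B}^{\mathrm{c}}(\Omega)$ is the set of all maps $R:U(\Omega)\to\mathbb{C}$ such that $R(\varphi,\cdot)$ is smooth (on the open set of $x$ with $(\varphi,x)\in U(\Omega)$) for each fixed $\varphi$. The derivatives $\mathrm{D}_i:\mathcal{B}^{\mathrm{c}}(\Omega)\to\mathcal{B}^{\mathrm{c}}(\Omega)$ are $(\mathrm{D}_iR)(\varphi,x)=\frac{\partial}{\partial x_i}R(\varphi,x)$. $\|g\|_{K,m}=\sup_{x\in K,|\alpha|\le m}|\partial^\alpha g(x)|$; $\|\varphi\|_c=\sup_{x\in\mathbb{R}^n,|\alpha|\le c}|\partial^\alpha\varphi(x)|$ for $\varphi\in\mathcal{D}(\mathbb{R}^n)$. For $\varphi\in\mathcal{D}(\mathbb{R}^n)$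 let $\varphi^\star(x)(y)=\varphi(y-x)$, and let $\vec\delta(x)=\delta_x$; for $B$ a set of smooth functions, $\|\varphi^\star-\vec\delta\|_{K,c;B}=\sup_{x\in K,|\alpha|\le c,f\in B}\left|\int f(y)\,\partial_x^\alpha(\varphi(y-x))\,dy-\partial^\alpha f(x)\right|$. $\mathcal{P}_0=\mathbb{R}^+[y_0]$ (polynomials with coefficients in $\mathbb{R}^+$), $\mathcal{I}_0=\{\lambda\in\mathbb{R}^+[y_0,z_0] : \lambda(y_0,0)=0\}$. $R\in\mathcal{M}^{\mathrm{c}}(\Omega)$ iff $R\in\mathcal{B}^{\mathrm{c}}(\Omega)$ and $(\forall x\in\Omega)(\exists U\in\mathcal{U}_x(\Omega))(\forall K,L\Subset U: K\Subset L)(\forall m\in\mathbb{N}_0)(\exists c\in\mathbb{N}_0)(\exists\lambda\in\mathcal{P}_0)(\forall\varphi\in\mathcal{D}(\mathbb{R}^n): K+\operatorname{supp}\varphi\subseteq L)$: $\|R(\varphi,\cdot)\|_{K,m}\le\lambda(\|\varphi\|_c)$. $R\in\mathcal{N}^{\mathrm{c}}(\Omega)$ iff $R\in\mathcal{B}^{\mathrm{c}}(\Omega)$ and $(\forall x\in\Omega)(\exists U\in\mathcal{U}_x(\Omega))(\forall K,L\Subset U: K\Subset L)(\forall m\in\mathbb{N}_0)(\exists c\in\mathbb{N}_0)(\exists\lambda\in\mathcal{I}_0)(\exists B\subseteq C^\infty(U)\text{ bounded})(\forall\varphi\in\mathcal{D}(\mathbb{R}^n): K+\operatorname{supp}\varphi\subseteq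 L)$: $\|R(\varphi,\cdot)\|_{K,m}\le\lambda(\|\varphi\|_c,\|\varphi^\star-\vec\delta\|_{K,c;B})$. *)

(* Defs.v *)
From HB Require Import structures.
From mathcomp Require Import all_boot all_order all_algebra.
From mathcomp Require Import complex.
From mathcomp Require Import all_classical all_reals all_analysis.

Set Implicit Arguments.
Unset Strict Implicit.
Unset Printing Implicit Defensive.

Import Order.TTheory GRing.Theory Num.Theory.
Import numFieldNormedType.Exports.

Local Open Scope classical_set_scope.
Local Open Scope ring_scope.

Lemma product_sigma_finite d1 d2 (T1 : measurableType d1)
    (T2 : measurableType d2) (R : realType)
    (m1 : {sigma_finite_measure set T1 -> \bar R})
    (m2 : {sigma_finite_measure set T2 -> \bar R}) :
  sigma_finite setT (m1 \x m2)%E.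
Proof.
have /sigma_finiteP[F [TF ndF Foo]] := sigma_finiteT m1.
have /sigma_finiteP[G [TG ndG Goo]] := sigma_finiteT m2.
exists (fun n => F n `*` G n).
  rewrite -setXTT TF TG predeqE => -[x y]; split.
    move=> [/= [n _ Fnx] [k _ Gky]]; exists (maxn n k) => //; split.
    - by move: x Fnx; exact/subsetPset/ndF/leq_maxl.
    - by move: y Gky; exact/subsetPset/ndG/leq_maxr.
  by move=> [n _ []/= ? ?]; split; exists n.
move=> k; have [? ?] := Foo k; have [? ?] := Goo k.
split; first exact: measurableX.
by rewrite product_measure1E// lte_mul_pinfty// ge0_fin_numE.
Qed.

(* Lebesgue measure on R^n is the n-fold product of [lebesgue_measure], carried
   by the measurable space [n.-tuple R]: the product measure lives on
   [R * n.-tuple R] and is transported to [n.+1.-tuple R] along [tuple_cons]. *)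
Section lebesgue_tuple.
Context {R : realType}.
Local Notation BR := (measurableTypeR R).

Definition tuple_cons n (p : BR * n.-tuple BR) : n.+1.-tuple BR :=
  [the n.+1.-tuple BR of p.1 :: p.2].

Definition tuple_uncons n (t : n.+1.-tuple BR) : BR * n.-tuple BR :=
  (tnth t ord0, [tuple of behead t]).

Lemma measurable_tuple_cons n : measurable_fun setT (@tuple_cons n).
Proof. exact: measurable_cons. Qed.

Lemma measurable_tuple_uncons n : measurable_fun setT (@tuple_uncons n).
Proof.
apply/measurable_fun_pairP; split.
  exact: measurable_tnth.
exact: measurable_behead.
Qed.

Lemma tuple_consK n : cancel (@tuple_cons n) (@tuple_uncons n).
Proof. by move=> [x t]; congr pair; exact/val_inj. Qed.

Section cons_measure.
Context (n : nat) (mu : {sigma_finite_measure set (n.-tuple BR) -> \bar R}).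

Definition cons_measure (A : set (n.+1.-tuple BR)) : \bar R :=
  (lebesgue_measure \x mu)%E (@tuple_cons n @^-1` A).

Let nu : {measure set (n.+1.-tuple BR) -> \bar R} :=
  @measure_function_pushforward__canonical__measure_function_Measure
    _ _ _ _ _ (lebesgue_measure \x mu)%E _ (@measurable_tuple_cons n).

Let cons_measure0 : cons_measure set0 = 0%E. Proof. exact: (measure0 nu). Qed.

Let cons_measure_ge0 A : (0 <= cons_measure A)%E.
Proof. exact: (measure_ge0 nu). Qed.

Let cons_measure_sigma_additive : semi_sigma_additive cons_measure.
Proof. exact: (@measure_semi_sigma_additive _ _ _ nu). Qed.

HB.instance Definition _ := isMeasure.Build _ _ _ cons_measure
  cons_measure0 cons_measure_ge0 cons_measure_sigma_additive.

Let cons_measure_sigma_finite : sigma_finite setT cons_measure.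
Proof.
have [F FT Foo] := product_sigma_finite (@lebesgue_measure R) mu.
exists (fun k => @tuple_uncons n @^-1` F k).
  by rewrite -preimage_bigcup -FT preimage_setT.
move=> k; have [mFk Fk] := Foo k; split.
  by rewrite -[X in measurable X]setTI; exact: measurable_tuple_uncons.
rewrite /cons_measure -comp_preimage.
by have -> : @tuple_uncons n \o @tuple_cons n = id
  by apply/funext => x /=; rewrite tuple_consK.
Qed.

HB.instance Definition _ := Measure_isSigmaFinite.Build _ _ _ cons_measure
  cons_measure_sigma_finite.

End cons_measure.

Fixpoint lebesgue_tuple n : {sigma_finite_measure set (n.-tuple BR) -> \bar R} :=
  match n with
  | 0 => \d_ ([tuple] : 0.-tuple BR)
  | m.+1 => cons_measure (lebesgue_tuple m)
  end.

End lebesgue_tuple.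

Section calculus.
Context {R : realType} {n : nat}.
Local Notation V := 'rV[R]_n.
Local Notation C := R[i].
Implicit Types (f : V -> C) (x : V) (D K L U : set V) (a : 'I_n -> nat).

(* Continuity, derivatives and integrals of complex-valued functions are taken
   on real and imaginary parts. *)
Definition rep f : V -> R := fun x => complex.Re (f x).
Definition imp f : V -> R := fun x => complex.Im (f x).

Definition cintegral f : C :=
  Complex (\int[lebesgue_tuple n]_t rep f (\row_j tnth t j))
          (\int[lebesgue_tuple n]_t imp f (\row_j tnth t j)).

Definition basis_vec (i : 'I_n) : V := delta_mx 0 i.

Definition pderivable (i : 'I_n) f x : Prop :=
  derivable (rep f) x (basis_vec i) /\ derivable (imp f) x (basis_vec i).

Definition pderiv (i : 'I_n) f : V -> C := fun x =>
  Complex ('D_(basis_vec i) (rep f) x) ('D_(basis_vec i) (imp f) x).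

Fixpoint Ck (k : nat) D f : Prop :=
  (forall x, D x -> {for x, continuous (rep f)} /\ {for x, continuous (imp f)})
  /\ (if k is k'.+1 then
        forall i, (forall x, D x -> pderivable i f x) /\ Ck k' D (pderiv i f)
      else True).

(* Only used for open [D]; the values of [f] off [D] are irrelevant. *)
Definition Cinfty D f : Prop := forall k, Ck k D f.

Definition mdeg a : nat := (\sum_i a i)%N.

(* d_0^(a 0) o ... o d_(n-1)^(a (n-1)) *)
Definition mpderiv a f : V -> C :=
  foldr (fun i g => iter (a i) (pderiv i) g) f (enum 'I_n).

Definition cmod (z : C) : R := Normc.normc z.

(* ||g||_{K,m}; for empty K this is -oo. *)
Definition seminorm K (m : nat) (g : V -> C) : \bar R :=
  ereal_sup [set t | exists x a,
    [/\ K x, (mdeg a <= m)%N & t = (cmod (mpderiv a g x))%:E]].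

Definition compactly_inside K L : Prop := compact K /\ K `<=` interior L.

Definition supp f : set V := closure [set x | f x != 0].

Definition set_sum K L : set V := [set x + y | x in K & y in L].

Definition bounded_Cinfty U (B : set (V -> C)) : Prop :=
  B `<=` Cinfty U /\
  forall K m, compactly_inside K U ->
    exists M : R, forall f, B f -> (seminorm K m f <= M%:E)%E.

End calculus.

Record testfun (R : realType) (n : nat) := TestFun {
  testfun_fun :> 'rV[R]_n -> R[i];
  testfun_smooth : Cinfty setT testfun_fun;
  testfun_compact : compact (supp testfun_fun) }.

Section spaces.
Context {R : realType} {n : nat}.
Local Notation V := 'rV[R]_n.
Local Notation C := R[i].
Implicit Types (phi : testfun R n) (Omega U K L : set V).

Definition testnorm (c : nat) phi : \bar R := seminorm setT c phi.

(* || phi^* - delta ||_{K,c;B}.  When [B] consists of functions smooth on an open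
   set containing K + supp phi, the values of [f] off that set do not
   contribute, as [phi (y - z)] and its z-derivatives vanish there for z in K. *)
Definition deltanorm K (c : nat) (B : set (V -> C)) phi : \bar R :=
  ereal_sup [set t | exists x a f, [/\ K x, (mdeg a <= c)%N, B f &
    t = (cmod (cintegral (fun y => f y * mpderiv a (fun z => phi (y - z)) x)
               - mpderiv a f x))%:E]].

Definition Udom Omega : set (testfun R n * V) :=
  [set p : testfun R n * V |
    Omega p.2 /\ set_sum [set p.2] (supp p.1) `<=` Omega].

(* Maps on U(Omega) are represented by total functions, whose values off
   [Udom Omega] are never constrained nor used. *)
Definition Bc Omega : set (testfun R n -> V -> C) :=
  [set F | forall phi, Cinfty [set x | Udom Omega (phi, x)] (F phi)].

Definition Dop (i : 'I_n) (F : testfun R n -> V -> C) : testfun R n -> V -> C :=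
  fun phi => pderiv i (F phi).

Definition P0 : {pred {poly R}} := polyOver Num.nneg.

(* R^+[y0, z0]: the outer variable is z0 and the coefficients lie in R^+[y0], so
   [l.[0]] is l(y0, 0) and [l.[z%:P].[y]] is l(y, z). *)
Definition I0 : {pred {poly {poly R}}} :=
  [pred l | (l \is a polyOver P0) && (l.[0] == 0)].

(* [fine] below is applied to suprema that are finite (phi has compact support,
   K is compact, B is bounded) or, over an empty index set, equal to -oo; in the
   latter case it yields the conventional value 0. *)
Definition Mc Omega : set (testfun R n -> V -> C) :=
  [set F | Bc Omega F /\
    forall x, Omega x -> exists U, [/\ open U, U `<=` Omega, U x &
    forall K L, compactly_inside K U -> compactly_inside L U ->
      compactly_inside K L ->
    forall m : nat, exists (c : nat) (l : {poly R}), l \in P0 /\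
    forall phi, set_sum K (supp phi) `<=` L ->
      (seminorm K m (F phi) <= (l.[fine (testnorm c phi)])%:E)%E]].

Definition Nc Omega : set (testfun R n -> V -> C) :=
  [set F | Bc Omega F /\
    forall x, Omega x -> exists U, [/\ open U, U `<=` Omega, U x &
    forall K L, compactly_inside K U -> compactly_inside L U ->
      compactly_inside K L ->
    forall m : nat, exists (c : nat) (l : {poly {poly R}}) (B : set (V -> C)),
    [/\ l \in I0, bounded_Cinfty U B &
    forall phi, set_sum K (supp phi) `<=` L ->
      (seminorm K m (F phi) <=
       (l.[(fine (deltanorm K c B phi))%:P].[fine (testnorm c phi)])%:E)%E]]].

End spaces.

(* Main.v *)
Require Import Defs.
From mathcomp Require Import all_boot all_order all_algebra.
From mathcomp Require Import complex.
From mathcomp Require Import all_classical all_reals all_analysis.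
From mathcomp Require Import lra.

Set Implicit Arguments.
Unset Strict Implicit.
Unset Printing Implicit Defensive.

Import numFieldNormedType.Exports.
Import Order.TTheory GRing.Theory Num.Theory.

Local Open Scope classical_set_scope.
Local Open Scope ring_scope.

(** Moderateness and negligibility both bound, for every order [m], the seminorm
of [F phi] on [K].  Differentiating in the [x]-variable costs one order,
[seminorm K m (Dop i F phi) <= seminorm K m.+1 (F phi)],
so the data [c], [l] (and [B]) that serve [F] at order [m.+1] serve [Dop i F] at
order [m], with the same neighbourhood [U] (lemma [seminorm_Dop]).

This inequality is a comparison of index sets: every derivative [d^a d_i f] is
again a derivative [d^(a + e_i) f], of total degree one higher
([mpderiv_pderiv]).  Since multi-index derivatives apply the partial derivatives
in a fixed order, the inner [d_i] must be moved to its slot, which rests on the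
symmetry of second derivatives ([schwarz]) on an open set where [f] is smooth.
For [f = F phi] that set is the slice of U(Omega) at [phi]: it is open because
the support of [phi] is compact ([open_Udom]), and it contains [K] because
[K] and K + supp phi lie in Omega ([sub_Udom]). *)

(** * Symmetry of second derivatives *)

Section schwarz.
Context {R : realType} {V : normedModType R}.
Implicit Types (g : V -> R) (p u v x : V).

Lemma is_derive_line g p u (s : R) : derivable g (p + s *: u) u ->
  is_derive s 1 (fun t : R => g (p + t *: u)) ('D_u g (p + s *: u)).
Proof.
move=> dg.
have E : (fun h : R => h^-1 *: (((fun t : R => g (p + t *: u)) \o shift s) (h *: 1)
            - g (p + s *: u)))
       = (fun h : R => h^-1 *: ((g \o shift (p + s *: u)) (h *: u)
            - g (p + s *: u))).
  apply/funext => h /=.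
  by rewrite scaler1 scalerDl addrCA.
by split; rewrite /derivable /derive E.
Qed.

(** The mean value theorem along a segment asks for derivability in the direction
of that segment only; smoothness is given here through iterated directional
derivatives, not through differentials. *)
Lemma mvt_line g p u (h : R) : 0 < h ->
  (forall s, 0 <= s <= h -> derivable g (p + s *: u) u) ->
  exists2 s, 0 <= s <= h & g (p + h *: u) - g p = 'D_u g (p + s *: u) * h.
Proof.
move=> h0 dg.
have [||s] := @MVT _ (fun t : R => g (p + t *: u))
    (fun t => 'D_u g (p + t *: u)) 0 h h0.
- move=> s; rewrite in_itv/= => /andP[s0 sh].
  by apply/is_derive_line/dg; rewrite !ltW.
- apply: derivable_within_continuous => s; rewrite in_itv/= => sh.
  by have [] := is_derive_line (dg s sh).
rewrite in_itv/= => /andP[s0 sh]; rewrite scale0r addr0 subr0 => E.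
by exists s => //; rewrite !ltW.
Qed.

Lemma growth_rate_translate g w p u :
  (fun h : R => h^-1 *: (((fun q => g (q + w)) \o shift p) (h *: u) - g (p + w)))
  = (fun h : R => h^-1 *: ((g \o shift (p + w)) (h *: u) - g (p + w))).
Proof. by apply/funext => h /=; rewrite addrA. Qed.

Lemma derive_translate g w p u :
  'D_u (fun q => g (q + w)) p = 'D_u g (p + w).
Proof. by rewrite /derive growth_rate_translate. Qed.

Lemma derivable_translate g w p u : derivable g (p + w) u ->
  derivable (fun q => g (q + w)) p u.
Proof. by rewrite /derivable growth_rate_translate. Qed.

(** The left-hand side is the increment along [h *: u] of the difference
[q |-> g (q + h *: v) - g q], whose [u]-derivative is itself an increment of
['D_u g] along [h *: v]: two uses of the mean value theorem.  It is symmetric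
in [u] and [v], which is what makes the mixed derivatives comparable. *)
Lemma second_difference_mvt g x u v (h : R) : 0 < h ->
  (forall s t, 0 <= s <= h -> 0 <= t <= h ->
     derivable g (x + s *: u + t *: v) u /\
     derivable ('D_u g) (x + s *: u + t *: v) v) ->
  exists s t, [/\ 0 <= s <= h, 0 <= t <= h &
    g (x + h *: u + h *: v) - g (x + h *: u) - (g (x + h *: v) - g x) =
    'D_v ('D_u g) (x + s *: u + t *: v) * h * h].
Proof.
move=> h0 dg.
have h00 : 0 <= (0 : R) <= h by rewrite lexx ltW.
have hh : 0 <= h <= h by rewrite lexx ltW.
have dg0 s : 0 <= s <= h -> derivable g (x + s *: u) u.
  by move=> sh; have [+ _] := dg s 0 sh h00; rewrite scale0r addr0.
have dgh s : 0 <= s <= h ->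
    derivable (fun q => g (q + h *: v)) (x + s *: u) u.
  by move=> sh; apply: derivable_translate; have [] := dg s h sh hh.
have [s sh Es] := @mvt_line ((fun q => g (q + h *: v)) - g) x u h h0
  (fun s sh => derivableB (dgh s sh) (dg0 s sh)).
have [t th Et] := @mvt_line ('D_u g) (x + s *: u) v h h0
  (fun t th => (dg s t sh th).2).
exists s, t; split => //.
rewrite -Et -(derive_translate g).
by rewrite -(deriveB (dgh s sh) (dg0 s sh)) -Es.
Qed.

Lemma nbhs_parallelogram (N : set V) x u v : nbhs x N ->
  exists2 h : R, 0 < h &
    forall s t, 0 <= s <= h -> 0 <= t <= h -> N (x + s *: u + t *: v).
Proof.
move=> /nbhs_ballP[e /= e0 eN].
have c0 : 0 < 1 + `|u| + `|v| by rewrite -addrA ltr_wpDr// addr_ge0.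
(* The summand 1 keeps the denominator positive when u = v = 0. *)
exists (e / (2 * (1 + `|u| + `|v|))); first by rewrite divr_gt0// mulr_gt0.
move=> s t /andP[s0 sh] /andP[t0 th]; apply: eN.
rewrite -ball_normE/= -addrA opprD addrA subrr sub0r normrN.
rewrite (le_lt_trans (ler_normD _ _))// !normrZ (ger0_norm s0) (ger0_norm t0).
set h := e / _ in sh th.
have hE : h * (1 + `|u| + `|v|) = e / 2.
  by rewrite /h invfM mulrA mulfVK// gt_eqF.
have := ler_wpM2r (normr_ge0 u) sh; have := ler_wpM2r (normr_ge0 v) th.
have h0 : 0 < h by rewrite divr_gt0// mulr_gt0.
lra.
Qed.

(** Passing to the limit without sequences: [y] and [z] may differ, as do the two
intermediate points that the mean value theorem yields. *)
Lemma continuous_eq_of_close_values (F G : V -> R) x :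
  {for x, continuous F} -> {for x, continuous G} ->
  (forall N, nbhs x N -> exists y z, [/\ N y, N z & F y = G z]) ->
  F x = G x.
Proof.
move=> cF cG FG; apply/eqP/negPn/negP; rewrite -subr_eq0 -normr_gt0 => FGx.
have e0 : 0 < `|F x - G x| / 2 by rewrite divr_gt0.
have nF : \forall y \near x, `|F x - F y| < `|F x - G x| / 2.
  by move/cvgrPdist_lt : cF; apply.
have nG : \forall y \near x, `|G x - G y| < `|F x - G x| / 2.
  by move/cvgrPdist_lt : cG; apply.
have [y [z [[Fy _] [_ Gz] Fyz]]] := FG _ (filterI nF nG).
have := ler_distD (F y) (F x) (G x).
rewrite leNgt => /negP; apply; rewrite [ltRHS]splitr ltrD//.
by rewrite Fyz distrC.
Qed.

(** Exchanging [u] and [v] in [second_difference_mvt] expresses the same second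
difference through either mixed derivative, so the two take a common value (at
different points) in every neighbourhood of [x]; continuity at [x] concludes. *)
Lemma schwarz g (D : set V) x u v : open D -> D x ->
  (forall p, D p -> [/\ derivable g p u, derivable g p v,
     derivable ('D_u g) p v & derivable ('D_v g) p u]) ->
  {for x, continuous ('D_v ('D_u g))} ->
  {for x, continuous ('D_u ('D_v g))} ->
  'D_v ('D_u g) x = 'D_u ('D_v g) x.
Proof.
move=> oD Dx dg cuv cvu; apply: (continuous_eq_of_close_values cuv cvu) => N xN.
have [h h0 hN] := nbhs_parallelogram u v
  (filterI (open_nbhs_nbhs (conj oD Dx)) xN).
have [|s [t [sh th E1]]] := @second_difference_mvt g x u v h h0.
  by move=> s t sh th; have [] := dg _ (hN s t sh th).1.
have [|t' [s' [th' sh' E2]]] := @second_difference_mvt g x v u h h0.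
  move=> t' s' th' sh'; rewrite addrAC.
  by have [] := dg _ (hN s' t' sh' th').1.
rewrite (addrAC x (t' *: v)) (addrAC x (h *: v)) in E2.
exists (x + s *: u + t *: v), (x + s' *: u + t' *: v).
split; [exact: (hN s t sh th).2|exact: (hN s' t' sh' th').2|].
apply: (mulIf (lt0r_neq0 h0)); apply: (mulIf (lt0r_neq0 h0)).
have swap (a b c d : R) : a - b - (c - d) = a - c - (b - d) by lra.
exact: etrans (etrans (esym E1) (swap _ _ _ _)) E2.
Qed.

End schwarz.

(** * Partial derivatives of smooth complex functions *)

Section multi_index.
Context {R : realType} {n : nat}.
Local Notation V := 'rV[R]_n.
Implicit Types (f g : V -> R[i]) (D : set V) (a : 'I_n -> nat) (s : seq 'I_n).

Lemma Cinfty_pderiv D i f : Cinfty D f -> Cinfty D (pderiv i f).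
Proof. by move=> Cf k; have [_ /(_ i)[]] := Cf k.+1. Qed.

Lemma Cinfty_iter_pderiv D i k f : Cinfty D f -> Cinfty D (iter k (pderiv i) f).
Proof. by move=> Cf; elim: k => //= k; exact: Cinfty_pderiv. Qed.

Lemma Cinfty_foldr_pderiv D a s f : Cinfty D f ->
  Cinfty D (foldr (fun i g => iter (a i) (pderiv i) g) f s).
Proof. by move=> Cf; elim: s => //= j s; exact: Cinfty_iter_pderiv. Qed.

(** Openness of [D] is essential: equality at the points of [D] has to hold near
each of them to pass to derivatives.  This is what lets identities valid only
on [D] be rewritten under further derivatives. *)
Lemma eq_in_pderiv D i f g : open D -> {in D, f =1 g} ->
  {in D, pderiv i f =1 pderiv i g}.
Proof.
move=> oD fg x /set_mem Dx; rewrite /pderiv.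
have nfg : \forall y \near x, f y = g y.
  apply: filterS (open_nbhs_nbhs (conj oD Dx)) => y Dy.
  by apply: fg; exact: mem_set.
by congr Complex; apply: near_eq_derive; apply: filterS nfg => y;
  rewrite /rep /imp => ->.
Qed.

Lemma eq_in_iter_pderiv D i k f g : open D -> {in D, f =1 g} ->
  {in D, iter k (pderiv i) f =1 iter k (pderiv i) g}.
Proof. by move=> oD fg; elim: k => //= k; exact: eq_in_pderiv. Qed.

Lemma pderivC D i j f : open D -> Cinfty D f ->
  {in D, pderiv i (pderiv j f) =1 pderiv j (pderiv i f)}.
Proof.
move=> oD Cf x /set_mem Dx.
have d l p : D p -> pderivable l f p.
  by move=> Dp; have [_ /(_ l)[+ _]] := Cf 1%N; exact.
have dd k l p : D p -> pderivable k (pderiv l f) p.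
  move=> Dp; have [_ /(_ k)[+ _]] := Cinfty_pderiv l Cf 1%N; exact.
have c k l := (Cinfty_pderiv k (Cinfty_pderiv l Cf) 0%N).1 x Dx.
have Re_sym : 'D_(basis_vec i) ('D_(basis_vec j) (rep f)) x
            = 'D_(basis_vec j) ('D_(basis_vec i) (rep f)) x.
  apply: (@schwarz _ _ (rep f) D x (basis_vec j) (basis_vec i) oD Dx).
  - move=> p Dp; split; [exact: (d j p Dp).1|exact: (d i p Dp).1
      |exact: (dd i j p Dp).1|exact: (dd j i p Dp).1].
  - exact: (c i j).1.
  - exact: (c j i).1.
have Im_sym : 'D_(basis_vec i) ('D_(basis_vec j) (imp f)) x
            = 'D_(basis_vec j) ('D_(basis_vec i) (imp f)) x.
  apply: (@schwarz _ _ (imp f) D x (basis_vec j) (basis_vec i) oD Dx).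
  - move=> p Dp; split; [exact: (d j p Dp).2|exact: (d i p Dp).2
      |exact: (dd i j p Dp).2|exact: (dd j i p Dp).2].
  - exact: (c i j).2.
  - exact: (c j i).2.
exact: (f_equal2 (@Complex R) Re_sym Im_sym).
Qed.

Lemma iter_pderivC D i j k f : open D -> Cinfty D f ->
  {in D, iter k (pderiv j) (pderiv i f) =1 pderiv i (iter k (pderiv j) f)}.
Proof.
move=> oD Cf; elim: k => //= k IH x Dx.
apply: etrans (eq_in_pderiv j oD IH Dx) _.
exact: pderivC oD (Cinfty_iter_pderiv j k Cf) x Dx.
Qed.

Definition incr_index i a : 'I_n -> nat := fun j => (a j + (j == i))%N.

Lemma incr_index_same i a : incr_index i a i = (a i).+1.
Proof. by rewrite /incr_index eqxx addn1. Qed.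

Lemma incr_index_other i a j : j != i -> incr_index i a j = a j.
Proof. by rewrite /incr_index => /negbTE ->; rewrite addn0. Qed.

(** The derivative [pderiv i] starts innermost; it commutes outwards past every
factor other than that of [i], where it is absorbed as one more iteration.
Uniqueness of the entries of [s] ensures that it is absorbed exactly once. *)
Lemma foldr_pderiv_incr D i a s f : open D -> Cinfty D f ->
  uniq s -> i \in s ->
  {in D, foldr (fun j g => iter (a j) (pderiv j) g) (pderiv i f) s =1
         foldr (fun j g => iter (incr_index i a j) (pderiv j) g) f s}.
Proof.
move=> oD Cf.
have comm r : {in D, foldr (fun j g => iter (a j) (pderiv j) g) (pderiv i f) r
    =1 pderiv i (foldr (fun j g => iter (a j) (pderiv j) g) f r)}.
  elim: r => //= j r IH x Dx.
  apply: etrans (eq_in_iter_pderiv j (a j) oD IH Dx) _.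
  exact: iter_pderivC oD (Cinfty_foldr_pderiv a r Cf) x Dx.
elim: s => //= j s IH /andP[js us]; rewrite inE => /predU1P[ij|is_] x Dx.
  subst j; apply: etrans (eq_in_iter_pderiv i (a i) oD (comm s) Dx) _.
  rewrite incr_index_same iterSr.
  suff -> : foldr (fun j g => iter (incr_index i a j) (pderiv j) g) f s
      = foldr (fun j g => iter (a j) (pderiv j) g) f s by [].
  elim: s js {us IH} => //= k s IH; rewrite inE negb_or => /andP[ik ks].
  by rewrite IH// incr_index_other// eq_sym.
have ji : j != i by apply: contraNneq js => ->.
rewrite (incr_index_other _ ji).
exact: (eq_in_iter_pderiv _ _ oD (IH us is_)).
Qed.

Lemma mpderiv_pderiv D i a f : open D -> Cinfty D f ->
  {in D, mpderiv a (pderiv i f) =1 mpderiv (incr_index i a) f}.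
Proof.
by move=> oD Cf; apply: foldr_pderiv_incr; rewrite ?enum_uniq ?mem_enum.
Qed.

Lemma mdeg_incr i a : mdeg (incr_index i a) = (mdeg a).+1.
Proof.
rewrite /mdeg big_split/= -addn1; congr addn.
by rewrite (bigD1 i)//= eqxx big1 ?addn0// => j /negbTE ->.
Qed.

Lemma seminorm_pderiv (D K : set V) m i f : open D -> K `<=` D -> Cinfty D f ->
  (seminorm K m (pderiv i f) <= seminorm K m.+1 f)%E.
Proof.
move=> oD KD Cf; apply: ereal_sup_le => _ [x [a [Kx am ->]]].
exists x, (incr_index i a); split; rewrite ?mdeg_incr//.
by rewrite (mpderiv_pderiv _ _ oD Cf)//; exact/mem_set/KD.
Qed.

End multi_index.

(** * Slices of U(Omega) and the loss of one order *)

Section domain.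
Context {R : realType} {n : nat}.
Local Notation V := 'rV[R]_n.
Implicit Types (Omega K L U : set V) (phi : testfun R n).

(** A tube argument: openness of [Omega] gives for each [z] of the support a
neighbourhood of [(x, z)] whose sums stay in [Omega], and compactness of the
support makes the condition on [x] uniform in [z]. *)
Lemma open_Udom Omega phi : open Omega -> open [set x | Udom Omega (phi, x)].
Proof.
move=> oO; rewrite openE => x [/= Ox sO].
have nO : \forall y \near x, Omega y by exact: open_nbhs_nbhs.
have nS : \forall y \near x, supp phi `<=` (fun z => Omega (y + z)).
  have /compact_near_coveringP cover := @testfun_compact _ _ phi.
  apply: (cover _ (nbhs x) (fun y z => Omega (y + z))) => z Sz.
  have Oxz : Omega (x + z) by apply: sO; exists x => //; exists z.
  have := @add_continuous V (x, z) _ (open_nbhs_nbhs (conj oO Oxz)).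
  case=> -[/= A B] [xA zB] AB; exists (B, A) => //= -[b c] [/= Bb Ac].
  exact: (AB (c, b)).
apply: filterS2 nO nS => y Oy Sy; split => //= _ [_ -> [z Sz <-]].
exact: Sy.
Qed.

(** The support of [phi] may miss 0, so that [K] itself need not lie in
K + supp phi: the point and its translated support are placed in [Omega]
separately, through [K] and through [L]. *)
Lemma sub_Udom Omega K L U phi : U `<=` Omega -> compactly_inside K U ->
  compactly_inside L U -> set_sum K (supp phi) `<=` L ->
  K `<=` [set x | Udom Omega (phi, x)].
Proof.
move=> UO [_ KU] [_ LU] KL x Kx; split => /=.
  exact: UO (interior_subset (KU x Kx)).
move=> _ [_ -> [z Sz <-]].
have Lxz : L (x + z) by apply: KL; exists x => //; exists z.
exact: UO (interior_subset (LU _ Lxz)).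
Qed.

Lemma Bc_Dop Omega i (F : testfun R n -> V -> R[i]) :
  Bc Omega F -> Bc Omega (Dop i F).
Proof. by move=> BF phi; exact: Cinfty_pderiv. Qed.

Lemma seminorm_Dop Omega K L U i m (F : testfun R n -> V -> R[i]) phi :
  open Omega -> Bc Omega F -> U `<=` Omega -> compactly_inside K U ->
  compactly_inside L U -> set_sum K (supp phi) `<=` L ->
  (seminorm K m (Dop i F phi) <= seminorm K m.+1 (F phi))%E.
Proof.
move=> oO BF UO KU LU KL.
have oD : open [set x | Udom Omega (phi, x)] by exact: open_Udom.
have KD : K `<=` [set x | Udom Omega (phi, x)] := sub_Udom UO KU LU KL.
exact (seminorm_pderiv m i oD KD (BF phi)).
Qed.

End domain.

Theorem theorem23 (R : realType) (n : nat) (Omega : set 'rV[R]_n)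
    (openOmega : open Omega) (i : 'I_n) :
  (Dop i @` Mc Omega `<=` Mc Omega) /\ (Dop i @` Nc Omega `<=` Nc Omega).
Proof.
split => _ [F [BF HF] <-]; (split; first exact: Bc_Dop) => x Ox;
  have [U [oU UO Ux HU]] := HF x Ox; exists U; split=> // K L KU LU KL m.
- have [c [l [lP lF]]] := HU K L KU LU KL m.+1.
  exists c, l; split=> // phi KphiL.
  exact (le_trans (seminorm_Dop i m openOmega BF UO KU LU KphiL)
                  (lF phi KphiL)).
- have [c [l [B [lI bB lF]]]] := HU K L KU LU KL m.+1.
  exists c, l, B; split=> // phi KphiL.
  exact (le_trans (seminorm_Dop i m openOmega BF UO KU LU KphiL)
                  (lF phi KphiL)).
Qed.
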